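(* Let $\mathfrak g$ be one of the basic simple finite-dimensional Lie superalgebras $sl(2|m)$ ($m\ge3$), $psl(2|2)$, $osp(4|m)$ ($m>2$ even), $spo(2|m)$ ($m\ge3$), $D(2,1;a)$ ($a\in\mathbb R\setminus\{0,-1\}$), $F(4)$, $G(3)$ over $\mathbb C$, with an $sl_2$-triple $\{e,x,f\}$ defining a minimal grading $\mathfrak g=\mathbb Cf\oplus\mathfrak g_{-1/2}\oplus\mathfrak g_0\oplus\mathfrak g_{1/2}\oplus\mathbb Ce$ by $\mathrm{ad}\,x$-eigenspaces compatible with parity. Assume that the $\mathfrak g_0$-module $\mathfrak g_{1/2}$ is irreducible. Then an almost compact conjugate linear involution of $\mathfrak g$ is uniquely determined up to a sign by its action on $\mathfrak g_0$; that is, if $\phi$ and $\phi'$ are almost compact conjugate linear involutions with $\phi|_{\mathfrak g_0}=\phi'|_{\mathfrak g_0}$, then there is $\varepsilon\in\{1,-1\}$ such that $\phi'(a)=\varepsilon^{2j}\phi(a)$ for all $a\in\mathfrak g_j$ and all $j\in\{0,\pm\frac12,\pm1\}$.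
   Context: An $sl_2$-triple $\{e,x,f\}\subset\mathfrak g_{\bar0}$ satisfies $[x,e]=e$, $[x,f]=-f$, $[e,f]=x$. $\mathfrak g_j$ denotes the $j$-eigenspace of $\mathrm{ad}\,x$; compatibility with parity means that $\mathfrak g_j$ has parity $2j\bmod2$. In this case $\mathfrak g_{\bar 0}=\mathfrak s\oplus\mathfrak g^\natural$ with $\mathfrak s=\mathrm{span}\{e,x,f\}$ and $\mathfrak g^\natural$ the centralizer of $\mathfrak s$ in $\mathfrak g$, and $\mathfrak g_0=\mathbb Cx\oplus\mathfrak g^\natural$. A conjugate linear involution $\phi$ of $\mathfrak g$ is a parity preserving conjugate linear map with $\phi([a,b])=[\phi(a),\phi(b)]$ and $\phi^2=\mathrm{id}$. It is called almost compact if (i) $\phi$ fixes $e,x,f$, and (ii) $\phi$ restricts to a compact conjugate linear involution of the reductive Lie algebra $\mathfrak g^\natural$, i.e. its fixed point set in $\mathfrak g^\natural$ is a compact real form of $\mathfrak g^\natural$. *)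

(* Defs.v *)
From HB Require Import structures.
From mathcomp Require Import all_boot all_order all_algebra.
From mathcomp Require Import complex.
From mathcomp Require Import reals.
From mathcomp Require Import ring.

Set Implicit Arguments.
Unset Strict Implicit.
Unset Printing Implicit Defensive.

Import Order.TTheory GRing.Theory Num.Theory.
Local Open Scope ring_scope.

(** * Finite-dimensional Lie superalgebras *)

(* Parities are booleans ([false] even, [true] odd), added by [(+)]. *)
Record lieSuperalgebra (K : fieldType) := LieSuperalgebra {
  lsa_sort :> vectType K;
  lsa_br : lsa_sort -> lsa_sort -> lsa_sort;
  lsa_part : bool -> {vspace lsa_sort};
  lsa_br_linearl : forall b, linear (lsa_br^~ b);
  lsa_br_linearr : forall a, linear (lsa_br a);
  lsa_part_add : (lsa_part false + lsa_part true = fullv)%VS;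
  lsa_part_cap : (lsa_part false :&: lsa_part true = 0)%VS;
  lsa_br_part : forall s t a b,
    a \in lsa_part s -> b \in lsa_part t -> lsa_br a b \in lsa_part (s (+) t);
  lsa_br_anti : forall s t a b, a \in lsa_part s -> b \in lsa_part t ->
    lsa_br b a = - ((-1) ^+ (s && t) *: lsa_br a b);
  lsa_jacobi : forall s t a b c, a \in lsa_part s -> b \in lsa_part t ->
    lsa_br a (lsa_br b c) =
      lsa_br (lsa_br a b) c + (-1) ^+ (s && t) *: lsa_br b (lsa_br a c)
}.

Arguments lsa_br {K l} a b.
Arguments lsa_part {K} l s.

Notation "[< a , b >]" := (lsa_br a b)
  (at level 0, a, b at level 69, format "[< a ,  b >]") : ring_scope.

Section LieSuperalgebraTheory.
Variables (K : fieldType) (g : lieSuperalgebra K).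
Implicit Types (a b c : g) (U I J : {vspace g}).

HB.instance Definition _ a :=
  GRing.isLinear.Build K g g *:%R (@lsa_br K g a) (lsa_br_linearr a).

Definition ad a : 'End(g) := linfun (@lsa_br K g a).

Lemma adE a b : ad a b = [<a, b>].
Proof. exact: lfunE. Qed.

Lemma mem_leigenspace_ad (x a : g) (k : K) :
  (a \in passmx.leigenspace (ad x) k) = ([<x, a>] == k *: a).
Proof.
by rewrite memv_ker add_lfunE opp_lfunE scale_lfunE id_lfunE adE subr_eq0.
Qed.

(* Ideals of a Lie superalgebra are Z/2-graded by convention. *)
Definition graded_ideal I : Prop :=
  (I = I :&: lsa_part g false + I :&: lsa_part g true)%VS /\
  (forall a b, b \in I -> [<a, b>] \in I).

Definition simple_lsa : Prop :=
  (exists a b, [<a, b>] != 0) /\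
  (forall I, graded_ideal I -> I = 0%VS \/ I = fullv).

Definition even_ideal I : Prop :=
  (I <= lsa_part g false)%VS /\
  (forall a b, a \in lsa_part g false -> b \in I -> [<a, b>] \in I).

(* The adjoint representation of the even part is completely reducible. *)
Definition even_reductive : Prop :=
  forall I, even_ideal I -> exists J,
    [/\ even_ideal J, (I + J = lsa_part g false)%VS & (I :&: J = 0)%VS].

Definition invariant_form (B : g -> g -> K) : Prop :=
  [/\ (forall (k : K) a b c, B (k *: a + b) c = k * B a c + B b c),
      (forall a b, a \in lsa_part g false -> b \in lsa_part g true ->
         B a b = 0),
      (forall s t a b, a \in lsa_part g s -> b \in lsa_part g t ->
         B b a = (-1) ^+ (s && t) * B a b),
      (forall a b c, B [<a, b>] c = B a [<b, c>]) &
      (forall a, (forall b, B a b = 0) -> a = 0)].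

Definition basic_simple : Prop :=
  [/\ simple_lsa, even_reductive & exists B, invariant_form B].

End LieSuperalgebraTheory.

(** * The general linear Lie superalgebra gl(p|q) and its subquotients *)

Section GeneralLinear.
Variables (K : fieldType) (p q : nat).
Local Notation M := 'M[K]_(p + q).
Implicit Types (A B C : M).

Definition mx_part (s : bool) A : M :=
  if s then block_mx 0 (ursubmx A) (dlsubmx A) 0
  else block_mx (ulsubmx A) 0 0 (drsubmx A).

(* For homogeneous A and B this is AB - (-1)^{|A||B|} BA. *)
Definition mx_superbr A B : M :=
  A *m B - B *m A + (mx_part true B *m mx_part true A) *+ 2.

Lemma mx_part_linear s : linear (mx_part s).
Proof.
move=> k A B; rewrite /mx_part; case: s;
  rewrite scale_block_mx add_block_mx !scaler0 !addr0;
  by congr block_mx; apply/matrixP=> i j; rewrite !mxE.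
Qed.

HB.instance Definition _ s :=
  GRing.isLinear.Build K M M *:%R (mx_part s) (mx_part_linear s).

Lemma mx_part_sum A : mx_part false A + mx_part true A = A.
Proof. by rewrite add_block_mx !addr0 !add0r submxK. Qed.

Lemma mx_part_mx_part s t A :
  mx_part s (mx_part t A) = if s == t then mx_part t A else 0.
Proof.
by case: s; case: t; rewrite /mx_part /=
  ?block_mxKul ?block_mxKur ?block_mxKdl ?block_mxKdr ?block_mx0.
Qed.

Definition gl_part (s : bool) : {vspace M} := limg (linfun (mx_part s)).

Lemma mem_gl_part s A : (A \in gl_part s) = (mx_part s A == A).
Proof.
apply/idP/eqP => [/memv_imgP[B _ ->]|<-].
  by rewrite lfunE /= mx_part_mx_part eqxx.
by rewrite -[X in X \in _](lfunE (mx_part s)) memv_img ?memvf.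
Qed.

Lemma gl_partE s t A : A \in gl_part s -> mx_part t A = if t == s then A else 0.
Proof.
by rewrite mem_gl_part => /eqP <-; rewrite mx_part_mx_part; case: eqP => // ->.
Qed.

Lemma mx_superbrE s t A B : A \in gl_part s -> B \in gl_part t ->
  mx_superbr A B = A *m B - (-1) ^+ (s && t) *: (B *m A).
Proof.
move=> As Bt; rewrite /mx_superbr (gl_partE _ As) (gl_partE _ Bt).
case: s As => As; case: t Bt => Bt; rewrite /= ?mul0mx ?mulmx0 ?mul0rn ?addr0
  ?expr0 ?scale1r //.
by rewrite expr1 scaleN1r opprK mulr2n addrA subrK.
Qed.

Lemma mx_superbr_linearl B : linear (mx_superbr^~ B).
Proof.
move=> k A C; rewrite /mx_superbr (mx_part_linear true) !mulmxDl !mulmxDr.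
by rewrite -!scalemxAl -!scalemxAr; apply/matrixP=> i j; rewrite !mxE; ring.
Qed.

Lemma mx_superbr_linearr A : linear (mx_superbr A).
Proof.
move=> k B C; rewrite /mx_superbr (mx_part_linear true) !mulmxDl !mulmxDr.
by rewrite -!scalemxAl -!scalemxAr; apply/matrixP=> i j; rewrite !mxE; ring.
Qed.

Lemma gl_part_mul s t A B : A \in gl_part s -> B \in gl_part t ->
  A *m B \in gl_part (s (+) t).
Proof.
rewrite !mem_gl_part => /eqP <- /eqP <-; apply/eqP.
case: s; case: t; rewrite /mx_part /= !mulmx_block ?mul0mx ?mulmx0 ?addr0 ?add0r
  ?block_mxKul ?block_mxKur ?block_mxKdl ?block_mxKdr //.
Qed.

Lemma mx_superbr_part s t A B : A \in gl_part s -> B \in gl_part t ->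
  mx_superbr A B \in gl_part (s (+) t).
Proof.
move=> As Bt; rewrite (mx_superbrE As Bt) rpredB ?gl_part_mul // rpredZ //.
by rewrite addbC gl_part_mul.
Qed.

Lemma mx_superbr_anti s t A B : A \in gl_part s -> B \in gl_part t ->
  mx_superbr B A = - ((-1) ^+ (s && t) *: mx_superbr A B).
Proof.
move=> As Bt; rewrite (mx_superbrE As Bt) (mx_superbrE Bt As) andbC.
rewrite scalerBr scalerA -expr2 sqrr_sign scale1r opprB; congr (_ - _).
Qed.

Lemma mx_superbr_jacobi s t A B C : A \in gl_part s -> B \in gl_part t ->
  mx_superbr A (mx_superbr B C) =
    mx_superbr (mx_superbr A B) C
      + (-1) ^+ (s && t) *: mx_superbr B (mx_superbr A C).
Proof.
move=> As Bt.
have hom u D : D \in gl_part u -> mx_superbr A (mx_superbr B D) =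
    mx_superbr (mx_superbr A B) D
      + (-1) ^+ (s && t) *: mx_superbr B (mx_superbr A D).
  move=> Du; rewrite (mx_superbrE As (mx_superbr_part Bt Du)).
  rewrite (mx_superbrE (mx_superbr_part As Bt) Du).
  rewrite (mx_superbrE Bt (mx_superbr_part As Du)).
  rewrite (mx_superbrE As Bt) (mx_superbrE As Du) (mx_superbrE Bt Du).
  rewrite !mulmxBl !mulmxBr -!scalemxAl -!scalemxAr !mulmxA.
  by case: (s) (t) (u) => [] [] [] /=; apply/matrixP=> i j; rewrite !mxE; ring.
have addr D E F : mx_superbr D (E + F) = mx_superbr D E + mx_superbr D F.
  by have := mx_superbr_linearr D 1 E F; rewrite !scale1r.
have pC u : mx_part u C \in gl_part u by rewrite mem_gl_part mx_part_mx_part eqxx.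
rewrite -[C]mx_part_sum; move: (pC false) (pC true).
move: (mx_part false C) (mx_part true C) => C0 C1 /hom homC0 /hom homC1.
rewrite (addr B) (addr A) (addr (mx_superbr A B)) (addr A C0) (addr B).
by rewrite homC0 homC1 addrACA -scalerDr.
Qed.

Lemma gl_part_add : (gl_part false + gl_part true = fullv)%VS.
Proof.
apply/eqP; rewrite eqEsubv subvf /=; apply/subvP=> A _.
by rewrite -[A]mx_part_sum memv_add ?mem_gl_part ?mx_part_mx_part ?eqxx.
Qed.

Lemma gl_part_cap : (gl_part false :&: gl_part true = 0)%VS.
Proof.
apply/eqP; rewrite -subv0; apply/subvP=> A; rewrite memv_cap => /andP[A0 A1].
rewrite memv0 -[A]mx_part_sum (gl_partE _ A1).
by rewrite (gl_partE _ A0 : mx_part true A = _) addr0.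
Qed.

Definition gl_lsa : lieSuperalgebra K :=
  LieSuperalgebra mx_superbr_linearl mx_superbr_linearr gl_part_add gl_part_cap
    mx_superbr_part mx_superbr_anti mx_superbr_jacobi.

Definition supertrace A : K := \tr (ulsubmx A) - \tr (drsubmx A).

Definition sl_super : {pred M} := [pred A | supertrace A == 0].

(* The Gram matrix J of a non-degenerate even form B(u,v) = u^T J v on K^(p|q)
   such that B(v,u) = eps (-1)^{|u||v|} B(u,v): supersymmetric for eps = 1,
   skew-supersymmetric for eps = -1. *)
Definition superform (eps : K) (J : M) : Prop :=
  [/\ J \in gl_part false, J \in unitmx,
      (ulsubmx J)^T = eps *: ulsubmx J & (drsubmx J)^T = - eps *: drsubmx J].

Definition parity_mx : M := block_mx 1%:M 0 0 (- 1%:M).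

(* The homogeneous components A_s of A satisfy
   B(A_s u, v) + (-1)^{s|u|} B(u, A_s v) = 0. *)
Definition osp_super (J : M) : {pred M} := [pred A |
  ((mx_part false A)^T *m J + J *m mx_part false A == 0) &&
  ((mx_part true A)^T *m J + parity_mx *m J *m mx_part true A == 0)].

End GeneralLinear.

(* g is isomorphic to S / (S :&: I), for S a graded subalgebra of h: F is any
   linear extension to h of the projection S -> g. *)
Definition subquotient_iso (K : fieldType) (h g : lieSuperalgebra K)
    (S I : {pred h}) : Prop :=
  exists F : 'Hom(h, g),
    [/\ (forall y, exists2 a, a \in S & F a = y),
        (forall a, a \in S -> (F a == 0) = (a \in I)),
        (forall a b, a \in S -> b \in S -> F [<a, b>] = [<F a, F b>]) &
        (forall s a, a \in S -> a \in lsa_part h s -> F a \in lsa_part g s)].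

Section Types.
Variable K : fieldType.
Implicit Type g : lieSuperalgebra K.

Definition is_sl (p q : nat) g : Prop :=
  @subquotient_iso K (gl_lsa K p q) g (@sl_super K p q) (pred1 0).

Definition is_psl (p : nat) g : Prop :=
  @subquotient_iso K (gl_lsa K p p) g (@sl_super K p p) (@is_scalar_mx K (p + p)).

Definition is_osp (p q : nat) g : Prop :=
  exists2 J : 'M[K]_(p + q), superform 1 J &
    @subquotient_iso K (gl_lsa K p q) g (osp_super J) (pred1 0).

Definition is_spo (p q : nat) g : Prop :=
  exists2 J : 'M[K]_(p + q), superform (-1) J &
    @subquotient_iso K (gl_lsa K p q) g (osp_super J) (pred1 0).

(* g is Kac's contragredient Lie superalgebra G(A, tau): Chevalley generators
   satisfy the relations of A, and no nonzero ideal meets the span of the h_i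
   trivially. The h_i being free, this determines g when A is invertible. *)
Definition contragredient (n : nat) (A : 'M[K]_n) (tau : pred 'I_n) g : Prop :=
  exists e f h : 'I_n -> g,
    [/\ [/\ forall i, e i \in lsa_part g (tau i),
            forall i, f i \in lsa_part g (tau i),
            forall i, h i \in lsa_part g false & free (codom h)],
        [/\ forall i j, [<h i, h j>] = 0,
            forall i j, [<e i, f j>] = if i == j then h i else 0,
            forall i j, [<h i, e j>] = A i j *: e j &
            forall i j, [<h i, f j>] = - A i j *: f j],
        (forall U : {vspace g},
            (forall i, e i \in U) -> (forall i, f i \in U) ->
            (forall a b, a \in U -> b \in U -> [<a, b>] \in U) ->
            U = fullv) &
        (forall I : {vspace g},
            graded_ideal I -> (I :&: <<codom h>> = 0)%VS -> I = 0%VS)].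

Definition mx_of_rows (n : nat) (r : seq (seq K)) : 'M[K]_n :=
  \matrix_(i, j) nth 0 (nth [::] r i) j.

(* The Cartan matrices of the distinguished simple root systems; only the first
   simple root is odd. *)
Definition cartan_D21 (a : K) : 'M[K]_3 := mx_of_rows 3
  [:: [::  0; 1; a];
      [:: -1; 2; 0];
      [:: -1; 0; 2]].

Definition cartan_F4 : 'M[K]_4 := mx_of_rows 4
  [:: [::  0;  1;  0;  0];
      [:: -1;  2; -2;  0];
      [::  0; -1;  2; -1];
      [::  0;  0; -1;  2]].

Definition cartan_G3 : 'M[K]_3 := mx_of_rows 3
  [:: [::  0;  1;  0];
      [:: -1;  2; -3];
      [::  0; -1;  2]].

Definition is_D21 (a : K) g : Prop :=
  contragredient (cartan_D21 a) (pred1 ord0) g.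
Definition is_F4 g : Prop := contragredient cartan_F4 (pred1 ord0) g.
Definition is_G3 g : Prop := contragredient cartan_G3 (pred1 ord0) g.

End Types.

(* sl(2|m), psl(2|2), osp(4|m), spo(2|m), D(2,1;a), F(4), G(3) over R[i]. *)
Definition in_list (R : realType) (g : lieSuperalgebra R[i]) : Prop :=
     (exists2 m, (3 <= m)%N & is_sl 2 m g)
  \/ is_psl 2 g
  \/ (exists2 m, (2 < m)%N && ~~ odd m & is_osp 4 m g)
  \/ (exists2 m, (3 <= m)%N & is_spo 2 m g)
  \/ (exists2 a : R, (a != 0) && (a != -1) & is_D21 a%:C%C g)
  \/ is_F4 g
  \/ is_G3 g.

(** * Minimal gradings *)

Section MinimalGrading.
Variables (K : fieldType) (g : lieSuperalgebra K).
Implicit Types (e x f : g).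

(* [grade x k] is the eigenspace g_(k/2): degrees are doubled. *)
Definition grade x (k : int) : {vspace g} := passmx.leigenspace (ad x) (k%:~R / 2).

Definition sl2_triple e x f : Prop :=
  [/\ [/\ e \in lsa_part g false, x \in lsa_part g false &
          f \in lsa_part g false],
      e != 0, [<x, e>] = e, [<x, f>] = - f & [<e, f>] = x].

Definition minimal_grading e x f : Prop :=
  [/\ (grade x (-2) + grade x (-1) + grade x 0 + grade x 1 + grade x 2
         = fullv)%VS,
      grade x (-2) = <[f]>%VS & grade x 2 = <[e]>%VS].

Definition parity_compatible x : Prop :=
  forall k : int, (grade x k <= lsa_part g (odd `|k|%N))%VS.

(* The centralizer g^natural of span{e, x, f}. *)
Definition centralizer_sl2 e x f : {vspace g} :=
  (lker (ad e) :&: lker (ad x) :&: lker (ad f))%VS.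

Definition irreducible_half x : Prop :=
  grade x 1 <> 0%VS /\
  forall U : {vspace g}, (U <= grade x 1)%VS ->
    (forall a u, a \in grade x 0 -> u \in U -> [<a, u>] \in U) ->
    U = 0%VS \/ U = grade x 1.

End MinimalGrading.

(** * Almost compact conjugate linear involutions *)

Section Involutions.
Variables (R : realType) (g : lieSuperalgebra R[i]).
Implicit Types (phi : g -> g) (k : g -> Prop) (h : {vspace g}).

Definition conj_linear_involution phi : Prop :=
  [/\ (forall (c : R[i]) a b, phi (c *: a + b) = c^* *: phi a + phi b),
      (forall s a, a \in lsa_part g s -> phi a \in lsa_part g s),
      (forall a b, phi [<a, b>] = [<phi a, phi b>]) &
      (forall a, phi (phi a) = a)].

Definition real_subalgebra k : Prop :=
  [/\ k 0, (forall (r : R) a b, k a -> k b -> k (r%:C%C *: a + b)) &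
      (forall a b, k a -> k b -> k [<a, b>])].

Definition real_form h k : Prop :=
  [/\ real_subalgebra k,
      (forall a, k a -> a \in h),
      (forall a, a \in h ->
         exists b c, [/\ k b, k c & a = b + 'i *: c]) &
      (forall b c, k b -> k c -> b + 'i *: c = 0 -> b = 0 /\ c = 0)].

(* A finite-dimensional real Lie algebra is compact when it carries an invariant
   (positive definite) inner product. *)
Definition compact_real_lie k : Prop :=
  exists B : g -> g -> R,
    [/\ (forall (r : R) a b c, k a -> k b -> k c ->
           B (r%:C%C *: a + b) c = r * B a c + B b c),
        (forall a b, k a -> k b -> B b a = B a b),
        (forall a b c, k a -> k b -> k c -> B [<a, b>] c = B a [<b, c>]) &
        (forall a, k a -> a != 0 -> 0 < B a a)].

Definition almost_compact (e x f : g) phi : Prop :=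
  let gnat := centralizer_sl2 e x f in
  let fixed a := a \in gnat /\ phi a = a in
  [/\ conj_linear_involution phi,
      [/\ phi e = e, phi x = x & phi f = f],
      real_form gnat fixed & compact_real_lie fixed].

End Involutions.

(* Main.v *)
Require Import Defs.
From HB Require Import structures.
From mathcomp Require Import all_boot all_order all_algebra.
From mathcomp Require Import complex.
From mathcomp Require Import reals.

Set Implicit Arguments.
Unset Strict Implicit.
Unset Printing Implicit Defensive.

Import Order.TTheory GRing.Theory Num.Theory.
Local Open Scope ring_scope.

(** The composite T = phi phi' is a complex linear automorphism of g which is
    the identity on g_0 and fixes e and f, so the claim is about such T: it must
    act on g_(k/2) as eps^k for a sign eps ([automorphism_eq_sign_power]).
    Applying phi to T then recovers phi', since the scalars eps^k are real.

    T commutes with the action of g_0 on the irreducible module g_(1/2), hence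
    is there a scalar lam, by Schur's lemma: the eigenspace of any eigenvalue is
    a submodule.  As ad f maps g_(1/2) onto g_(-1/2) and T fixes f, the same
    scalar lam occurs on g_(-1/2) ([br_f_e_half]).  For u in g_(1/2) and w in
    g_(-1/2) the bracket [u, w] lies in g_0, so it is fixed by T and also
    multiplied by lam^2; it remains to see that some such bracket is nonzero.

    This is where simplicity enters ([br_half_opp_neq0]).  If all these brackets
    vanished, then [u, v], a multiple of e for u and v in g_(1/2), would be
    killed by ad f and hence vanish; likewise in degree -1.  So any two odd
    elements would have bracket zero, and the odd part would be an ideal
    ([odd_bracket_neq0]), which is neither zero nor everything. *)

(** * Eigenvectors and Lie superalgebras *)

(** The eigenvector is found on the subspace U itself, by transporting T to a
    matrix of its restriction and using a root of the characteristic
    polynomial. *)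
Lemma stable_eigenvector (K : numClosedFieldType) (V : vectType K)
    (T : 'End(V)) (U : {vspace V}) :
  U <> 0%VS -> (forall u, u \in U -> T u \in U) ->
  exists lam u, [/\ u \in U, u != 0 & T u = lam *: u].
Proof.
move=> U0 TU; pose S : 'End(subvs_of U) := linfun (vsproj U \o T \o vsval).
pose e := vbasis {:subvs_of U}.
have be : basis_of {:subvs_of U} e := vbasisP _.
have dimU : (0 < \dim {:subvs_of U})%N.
  by rewrite dimvf /dim /= lt0n dimv_eq0; apply/eqP.
have [lam /eigenvalueP[v vS v0]] := eigenvalue_closed (passmx.mxof e e S) dimU.
exists lam, (vsval (passmx.vecof e v)); split; first exact: subvsP.
  by rewrite -(linear0 (@vsval _ _ U)) (inj_eq subvs_inj) passmx.vecof_eq0.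
have := passmx.hom_vecof e be S v; rewrite vS lfunE /=.
have -> : passmx.vecof e (lam *: v) = lam *: passmx.vecof e v.
  rewrite /passmx.vecof scaler_sumr.
  by apply: eq_bigr => i _; rewrite mxE scalerA.
by move=> /(congr1 vsval); rewrite vsprojK ?TU ?subvsP // linearZ.
Qed.

Section Superalgebra.
Variables (K : fieldType) (g : lieSuperalgebra K).
Implicit Types a b c : g.

Lemma lsa_br_Dl a b c : [<a + b, c>] = [<a, c>] + [<b, c>].
Proof. by have := lsa_br_linearl c 1 a b; rewrite !scale1r. Qed.

Lemma lsa_br_Zl k a b : [<k *: a, b>] = k *: [<a, b>].
Proof.
have br0 : [<0 : g, b>] = 0.
  by have := lsa_br_linearl b (-1) 0 0; rewrite scaler0 addr0 scaleN1r addNr.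
by have := lsa_br_linearl b k a 0; rewrite !addr0 br0 addr0.
Qed.

Lemma lsa_decomp a : exists a0 a1,
  [/\ a0 \in lsa_part g false, a1 \in lsa_part g true & a = a0 + a1].
Proof.
have : a \in (lsa_part g false + lsa_part g true)%VS.
  by rewrite lsa_part_add memvf.
by case/memv_addP=> a0 ? [a1 ? ->]; exists a0, a1.
Qed.

Lemma lsa_part_disjoint a :
  a \in lsa_part g false -> a \in lsa_part g true -> a = 0.
Proof. by move=> a0 a1; apply/eqP; rewrite -memv0 -lsa_part_cap memv_cap a0. Qed.

(** The sign in the Jacobi identity is trivial as soon as a is even, so b need
    not be homogeneous. *)
Lemma ad_even_derivation a b c : a \in lsa_part g false ->
  [<a, [<b, c>]>] = [<[<a, b>], c>] + [<b, [<a, c>]>].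
Proof.
move=> a0; have [b0 [b1 [hb0 hb1 ->]]] := lsa_decomp b.
rewrite !linearD /= !lsa_br_Dl linearD /= (lsa_jacobi c a0 hb0).
by rewrite (lsa_jacobi c a0 hb1) !scale1r addrACA.
Qed.

(** Were the bracket zero on the odd part, only even elements would act
    nontrivially on it, and these preserve parity: the odd part would be a
    proper nonzero ideal. *)
Lemma odd_bracket_neq0 : simple_lsa g -> lsa_part g true <> 0%VS ->
  lsa_part g false <> 0%VS ->
  ~ (forall a b, a \in lsa_part g true -> b \in lsa_part g true ->
       [<a, b>] = 0).
Proof.
move=> [_ simple] odd0 even0 br0.
have odd_ideal : graded_ideal (lsa_part g true).
  split=> [|a b hb]; first by rewrite capvC lsa_part_cap capvv add0v.
  have [a0 [a1 [ha0 ha1 ->]]] := lsa_decomp a.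
  by rewrite lsa_br_Dl (br0 a1) // addr0 (lsa_br_part ha0 hb).
case: (simple _ odd_ideal) => [//|full].
by apply: even0; rewrite -[LHS]capvf -full lsa_part_cap.
Qed.

End Superalgebra.

(** * The minimal grading *)

Section Grading.
Variables (K : numFieldType) (g : lieSuperalgebra K) (e x f : g).
Hypotheses (sl2 : sl2_triple e x f) (mingr : minimal_grading e x f)
  (parity : parity_compatible x).
Implicit Types (a b u v w : g) (k l : int).

Let x_even : x \in lsa_part g false. Proof. by case: sl2 => [[]]. Qed.
Let e_even : e \in lsa_part g false. Proof. by case: sl2 => [[]]. Qed.
Let f_even : f \in lsa_part g false. Proof. by case: sl2 => [[]]. Qed.

Lemma gradeP k a : reflect ([<x, a>] = (k%:~R / 2) *: a) (a \in grade x k).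
Proof. by rewrite mem_leigenspace_ad; apply: eqP. Qed.

Lemma grade_br k l a b :
  a \in grade x k -> b \in grade x l -> [<a, b>] \in grade x (k + l).
Proof.
move=> /gradeP ha /gradeP hb; apply/gradeP.
rewrite ad_even_derivation // ha hb lsa_br_Zl linearZ -scalerDl.
by rewrite -mulrDl -intrD.
Qed.

(** The five eigenspaces span g and three of them are even, so the difference
    between an odd element and its components of degree 1/2 and -1/2 is both
    odd and even. *)
Lemma odd_decomp a : a \in lsa_part g true ->
  exists w u, [/\ w \in grade x (-1), u \in grade x 1 & a = w + u].
Proof.
move=> a1; case: mingr => full _ _; have : a \in fullv := memvf a.
rewrite -full => /memv_addP[p4 p4_in [t ht Da]].
have [p3 p3_in [u hu Dp4]] := memv_addP p4_in.
have [p2 p2_in [z hz Dp3]] := memv_addP p3_in.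
have [y hy [w hw Dp2]] := memv_addP p2_in.
exists w, u; split=> //; apply/eqP; rewrite -subr_eq0; apply/eqP.
apply: lsa_part_disjoint; last first.
  by rewrite rpredB ?rpredD ?(subvP (parity (-1)) w hw) ?(subvP (parity 1) u hu).
have -> : a - (w + u) = y + z + t.
  by rewrite Da Dp4 Dp3 Dp2 [X in X - _](ACl (1*3*5*(2*4))%AC) /= addrK.
by rewrite !rpredD ?(subvP (parity (-2)) y hy) ?(subvP (parity 0) z hz)
  ?(subvP (parity 2) t ht).
Qed.

(** Being odd, an element of g_(k/2) has only components of degree 1/2 and
    -1/2, so (ad x)^2 multiplies it by 1/4.  It also multiplies it by k^2/4,
    and these agree only for k = 1 and k = -1. *)
Lemma odd_grade_eq0 k a : odd `|k|%N -> k != 1 -> k != -1 ->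
  a \in grade x k -> a = 0.
Proof.
move=> kodd k1 k_1 ha; have := subvP (parity k) a ha.
rewrite kodd => /odd_decomp[w [u [/gradeP hw /gradeP hu Da]]].
have xx c : [<x, a>] = c *: a -> [<x, [<x, a>]>] = (c * c) *: a.
  by move=> h; rewrite h linearZ /= h scalerA.
have := xx _ (gradeP _ _ ha); rewrite {1}Da !linearD /= hw hu !linearZ /= hw hu.
rewrite !scalerA /= rmorphN rmorph1 mulNr mulrNN -scalerDr -Da => /eqP.
rewrite -subr_eq0 -scalerBl scaler_eq0 => /orP[|/eqP//].
rewrite !mulf_div -mulrBl mulf_eq0 invr_eq0 mulf_eq0 pnatr_eq0 /= orbF.
rewrite mulr1 -intrM -[X in X - _]/(1%:~R) -intrB intr_eq0 subr_eq0.
rewrite eq_sym => /eqP kk.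
have : (k - 1) * (k + 1) == 0 by rewrite -subr_sqr expr2 kk expr1n subrr.
by rewrite mulf_eq0 subr_eq0 (negPf k1) addr_eq0 (negPf k_1).
Qed.

Lemma sl2_x_neq0 : x != 0.
Proof.
case: sl2 => _ e0 xe _ _; apply: contra_neq e0 => x0.
by rewrite -xe x0 -(scale0r e) lsa_br_Zl !scale0r.
Qed.

Lemma br_fe : [<f, e>] = - x.
Proof.
by case: sl2 => _ _ _ _ <-; rewrite (lsa_br_anti e_even f_even) scale1r.
Qed.

(** The sl2-relation that makes ad f onto g_(-1/2): the second term of the
    Leibniz rule vanishes because [f, w] has degree -3/2. *)
Lemma br_f_e_half w : w \in grade x (-1) -> [<f, [<e, w>]>] = 2^-1 *: w.
Proof.
move=> hw; rewrite ad_even_derivation // br_fe.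
have -> : [<f, w>] = 0.
  apply: (@odd_grade_eq0 (-2 + -1)) => //; apply: grade_br => //.
  by case: mingr => _ -> _; rewrite memv_line.
rewrite linear0 addr0 -scaleN1r lsa_br_Zl (gradeP _ _ hw) scalerA.
by rewrite rmorphN rmorph1 mulrA mulN1r opprK mul1r.
Qed.

(** The hypothesis propagates from g_(1/2) x g_(-1/2) to the whole odd part.
    For u, v of degree 1/2 the bracket [u, v] = c e satisfies
    0 = [f, [u, v]] = - c x, since [f, u] and [f, v] have degree -1/2; degree
    -1/2 is symmetric, with e in place of f. *)
Lemma br_half_opp_neq0 : simple_lsa g -> grade x 1 <> 0%VS ->
  ~ (forall u w, u \in grade x 1 -> w \in grade x (-1) -> [<u, w>] = 0).
Proof.
move=> simple g1 uw0.
have [e2 f2] : e \in grade x 2 /\ f \in grade x (-2).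
  by case: mingr => _ -> ->; rewrite !memv_line.
have wu0 u w : u \in grade x 1 -> w \in grade x (-1) -> [<w, u>] = 0.
  move=> hu hw; have u1 := subvP (parity 1) u hu.
  by rewrite (lsa_br_anti u1 (subvP (parity (-1)) w hw)) uw0 // scaler0 oppr0.
have uu0 u v : u \in grade x 1 -> v \in grade x 1 -> [<u, v>] = 0.
  move=> hu hv; have := grade_br hu hv; case: mingr => _ _ g2.
  rewrite [1 + 1]/(2 : int) g2 => /vlineP[c Duv].
  have : [<f, [<u, v>]>] = 0.
    have [fu fv] := (grade_br f2 hu, grade_br f2 hv).
    by rewrite ad_even_derivation // (wu0 v) // (uw0 u) // addr0.
  rewrite Duv linearZ /= br_fe scalerN => /eqP; rewrite oppr_eq0 scaler_eq0.
  by rewrite (negPf sl2_x_neq0) orbF => /eqP ->; rewrite scale0r.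
have ww0 u v : u \in grade x (-1) -> v \in grade x (-1) -> [<u, v>] = 0.
  move=> hu hv; have := grade_br hu hv; case: mingr => _ g2 _.
  rewrite [-1 + -1]/(-2 : int) g2 => /vlineP[c Duv].
  have : [<e, [<u, v>]>] = 0.
    have [eu ev] := (grade_br e2 hu, grade_br e2 hv).
    by rewrite ad_even_derivation // (uw0 _ v) // (wu0 _ u) // addr0.
  case: sl2 => _ _ _ _ ef.
  rewrite Duv linearZ /= ef => /eqP; rewrite scaler_eq0.
  by rewrite (negPf sl2_x_neq0) orbF => /eqP ->; rewrite scale0r.
apply: (odd_bracket_neq0 simple).
- move=> odd0; apply: g1; apply/eqP; rewrite -subv0 -odd0; exact: (parity 1).
- by move=> even0; have := sl2_x_neq0; rewrite -memv0 -even0 x_even.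
- move=> a b /odd_decomp[w [u [hw hu ->]]] /odd_decomp[w' [u' [hw' hu' ->]]].
  by rewrite lsa_br_Dl !linearD /= ww0 // wu0 // uw0 // uu0 // !addr0.
Qed.

End Grading.

(** * Automorphisms trivial on the sl2-triple and on degree zero *)

Lemma automorphism_eq_sign_power (K : numClosedFieldType)
    (g : lieSuperalgebra K) (e x f : g) (T : 'End(g)) :
  simple_lsa g -> sl2_triple e x f -> minimal_grading e x f ->
  parity_compatible x -> irreducible_half x ->
  (forall a b, T [<a, b>] = [<T a, T b>]) ->
  (forall a, a \in grade x 0 -> T a = a) -> T e = e -> T f = f ->
  exists2 eps : K, eps = 1 \/ eps = -1 &
    forall (k : int) a, (`|k| <= 2)%N -> a \in grade x k ->
      T a = eps ^ k *: a.
Proof.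
move=> simple sl2 mingr parity [g1 irr] Tbr T0 Te Tf.
have [[e_even x_even f_even] _ _ xf _] := sl2.
(* x commutes with itself, so it has degree 0. *)
have Tx : T x = x.
  apply: T0; apply/gradeP; rewrite mul0r scale0r.
  by case: sl2 => _ _ xe _ ef; rewrite -{2}ef ad_even_derivation // xe xf
    linearN /= ef subrr.
have Tgrade k a : a \in grade x k -> T a \in grade x k.
  by move=> /gradeP ha; apply/gradeP; rewrite -{1}Tx -Tbr ha linearZ.
have [lam [u0 [hu0 nu0 Tu0]]] := stable_eigenvector g1 (Tgrade 1).
have Tu u : u \in grade x 1 -> T u = lam *: u.
  (* Schur's lemma: U is a g_0-submodule containing u0. *)
  pose U := (grade x 1 :&: passmx.leigenspace T lam)%VS.
  have memU v : (v \in U) = (v \in grade x 1) && (T v == lam *: v).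
    rewrite memv_cap; congr (_ && _).
    by rewrite memv_ker add_lfunE opp_lfunE scale_lfunE id_lfunE subr_eq0.
  have Ustable a v : a \in grade x 0 -> v \in U -> [<a, v>] \in U.
    move=> ha; rewrite !memU => /andP[hv /eqP Tv].
    by rewrite (grade_br sl2 ha hv : _ \in grade x 1) Tbr T0 // Tv linearZ /=.
  case: (irr U (capvSl _ _) Ustable) => [U0|<-].
    by case/negP: nu0; rewrite -memv0 -U0 memU hu0 Tu0 eqxx.
  by rewrite memU => /andP[_ /eqP].
have e2 : e \in grade x 2 by case: mingr => _ _ ->; rewrite memv_line.
have Tw w : w \in grade x (-1) -> T w = lam *: w.
  move=> hw; have w2 := br_f_e_half sl2 mingr parity hw.
  have ew : [<e, w>] \in grade x 1 := grade_br sl2 e2 hw.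
  have -> : w = 2 *: [<f, [<e, w>]>].
    by rewrite w2 scalerA divff ?scale1r // pnatr_eq0.
  by rewrite linearZ /= Tbr Tf Tu // linearZ /= scalerA mulrC -scalerA.
have lam_sq : lam ^+ 2 = 1.
  apply/eqP/negPn/negP => lam_sq.
  apply: (br_half_opp_neq0 sl2 mingr parity simple g1) => u w hu hw.
  have := T0 _ (grade_br sl2 hu hw); rewrite Tbr Tu // Tw // lsa_br_Zl linearZ.
  move=> /eqP; rewrite scalerA -subr_eq0 -[X in _ - X]scale1r -scalerBl.
  by rewrite scaler_eq0 -expr2 subr_eq0 (negPf lam_sq) => /eqP.
have lam2 : lam = 1 \/ lam = -1.
  by move/eqP: lam_sq; rewrite sqrf_eq1 => /orP[]/eqP; [left|right].
have lamV : lam^-1 = lam by case: lam2 => ->; rewrite ?invrN invr1.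
(* k = 0, 1, 2, -1, -2 in turn. *)
exists lam => // -[[|[|[|k]]]|[|[|k]]] a // _ ha.
- by rewrite T0 ?scale1r.
- exact: Tu.
- case: mingr => _ _ g2; move: ha; rewrite g2 => /vlineP[c ->].
  by rewrite linearZ /= Te -exprnP lam_sq scale1r.
- by rewrite NegzE exprN1 lamV; apply: Tw.
- case: mingr => _ g2 _; move: ha; rewrite g2 => /vlineP[c ->].
  by rewrite linearZ /= Tf NegzE -exprnN lam_sq invr1 scale1r.
Qed.

Theorem proposition4p2 (R : realType) (g : lieSuperalgebra R[i])
    (g_basic : basic_simple g) (g_list : in_list g)
    (e x f : g) (sl2 : sl2_triple e x f) (mingr : minimal_grading e x f)
    (parity : parity_compatible x) (irr : irreducible_half x)
    (phi phi' : g -> g)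
    (phi_ac : almost_compact e x f phi) (phi'_ac : almost_compact e x f phi')
    (phi_eq : forall a, a \in grade x 0 -> phi a = phi' a) :
  exists2 eps : R[i], eps = 1 \/ eps = -1 &
    forall (k : int) (a : g), (`|k| <= 2)%N -> a \in grade x k ->
      phi' a = eps ^ k *: phi a.
Proof.
case: g_basic => simple _ _.
case: phi_ac => [[phiL _ phi_br phiK] [phi_e _ phi_f] _ _].
case: phi'_ac => [[phi'L _ phi'_br _] [phi'_e _ phi'_f] _ _].
have T_linear : linear (phi \o phi').
  by move=> c a b; rewrite /= phi'L phiL conjCK.
pose TL : {linear g -> g} := HB.pack (phi \o phi')
  (GRing.isLinear.Build _ _ _ _ (phi \o phi') T_linear).
have TE a : linfun TL a = phi (phi' a) by rewrite lfunE.
have phiZ c a : phi (c *: a) = c^* *: phi a.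
  have phi0 : phi 0 = 0.
    have := phiL (-1) 0 0.
    by rewrite scaler0 addr0 rmorphN rmorph1 scaleN1r addNr.
  by rewrite -[c *: a]addr0 phiL phi0 addr0.
have [|a ha|||eps eps1 Teps] :=
  @automorphism_eq_sign_power _ g e x f (linfun TL) simple sl2 mingr parity irr.
- by move=> a b; rewrite !TE phi'_br phi_br.
- by rewrite TE -phi_eq.
- by rewrite TE phi'_e.
- by rewrite TE phi'_f.
exists eps => // k a k2 ha.
have eps_real : (eps ^ k)^* = eps ^ k.
  by case: eps1 => ->; rewrite ?exp1rz ?rmorph1 // rmorphXz ?rmorphN1 ?unitrN1.
by rewrite -[LHS]phiK -TE (Teps k) // phiZ eps_real.
Qed.
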